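(* Let $a,b\in\mathbb{N}$ with $b\geq 2$, $b\neq 3$, $(a,b)=1$ and $1\leq a\leq b-1$. Then $S(1,a,b)=\frac{b}{2}$ if and only if there exists an integer $k$ with $0\leq k\leq b-2$ such that $b=3a+k+1$.
   Context: $\mathbb{N}$ denotes the positive integers and $(a,b)$ the greatest common divisor. For $n,a,b\in\mathbb{N}$ with $b\geq 2$, define $$S(n,a,b):=\sum_{m=1}^{b-1}\cot\left(\frac{\pi m}{b}\right)\sin^{3}\left(2\pi mn\frac{a}{b}\right).$$ *)

(* Defs.v *)
From HB Require Import structures.
From mathcomp Require Import all_boot all_order all_algebra.
From mathcomp Require Import reals trigo.
Set Implicit Arguments.
Unset Strict Implicit.
Unset Printing Implicit Defensive.
Import Order.TTheory GRing.Theory Num.Theory.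
Local Open Scope ring_scope.

Definition cot (R : realType) (x : R) : R := cos x / sin x.

Definition cot_sin3_sum (R : realType) (n a b : nat) : R :=
  \sum_(1 <= m < b)
    cot (pi * m%:R / b%:R) * sin (2 * pi * m%:R * n%:R * (a%:R / b%:R)) ^+ 3.

(* Main.v *)
(** The triple-angle formula gives S(1,a,b) = (3 T(a) - T(3a)) / 4 where
    T(k) = sum_m cot(pi m / b) sin(2 k pi m / b) is b-periodic in k and equals
    b - 2k for 0 < k < b.  The latter holds because
    T(k+1) - T(k) = sum_m (cos(2(k+1) pi m / b) + cos(2 k pi m / b)), and the
    cosine sums over 0 < m < b are -1 unless b divides k.  Hence S(1,a,b) is
    b/2, 0 or -b/2 according to whether 3a lies in (0,b), (b,2b) or (2b,3b);
    the endpoints are excluded by coprimality and b <> 3. *)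
Require Import Defs.
From mathcomp Require Import all_boot all_order all_algebra.
From mathcomp Require Import reals trigo.
From mathcomp Require Import ring zify.
Import Order.TTheory GRing.Theory Num.Theory.
Local Open Scope ring_scope.

Lemma sin_cube (R : realType) (x : R) :
  sin x ^+ 3 = (3 * sin x - sin (3 * x)) / 4.
Proof.
have -> : 3 * x = x + x + x by ring.
rewrite !sinD cosD.
have h := cos2Dsin2 x.
have -> : (sin x * cos x + cos x * sin x) * cos x
  + (cos x * cos x - sin x * sin x) * sin x
  = 3 * sin x * (cos x ^+ 2 + sin x ^+ 2) - 4 * sin x ^+ 3 by ring.
by rewrite h; field.
Qed.

Lemma sinD_2npi (R : realType) (x : R) (n : nat) : sin (x + 2 * n%:R * pi) = sin x.
Proof.
have -> : x + 2 * n%:R * pi = x + (pi *+ 2) *+ n by rewrite -mulr_natr mulr2n; ring.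
exact: periodicn (@sinD2pi R) n x.
Qed.

Lemma sin_pi_frac_gt0 (R : realType) (k b : nat) :
  (0 < k < b)%N -> 0 < sin (pi * k%:R / b%:R :> R).
Proof.
case/andP=> k_gt0 ltkb.
have b_gt0 : (0 : R) < b%:R by rewrite ltr0n; lia.
apply: sin_gt0_pi; apply/andP; split.
  by rewrite divr_gt0 // mulr_gt0 ?pi_gt0 ?ltr0n.
by rewrite ltr_pdivrMr // ltr_pM2l ?pi_gt0 // ltr_nat.
Qed.

(** Multiplying by [2 * sin t] with [t = pi * k / b] makes the sum telescope, and [sin t] is nonzero
    because [0 < k < b]. *)
Lemma sum_cos_roots_of_unity (R : realType) (k b : nat) : (0 < k < b)%N ->
  \sum_(1 <= m < b) cos (2 * k%:R * (pi * m%:R / b%:R)) = -1 :> R.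
Proof.
move=> hk; have sk := sin_pi_frac_gt0 R _ _ hk.
have b_neq0 : b%:R != 0 :> R by rewrite pnatr_eq0; lia.
set t := pi * k%:R / b%:R in sk.
have telescoped (n : nat) : 2 * sin t * \sum_(0 <= m < n) cos (2 * k%:R * (pi * m%:R / b%:R))
  = sin (2 * n%:R * t - t) + sin t.
  elim: n => [|n IHn].
    by rewrite big_geq // !mulr0 mul0r sub0r sinN addNr.
  rewrite big_nat_recr //= mulrDr IHn.
  have -> : 2 * k%:R * (pi * n%:R / b%:R) = 2 * n%:R * t by rewrite /t; ring.
  have -> : 2 * n.+1%:R * t - t = 2 * n%:R * t + t by rewrite -(natr1 n); ring.
  by rewrite sinB sinD; ring.
have := telescoped b.
(* At [n = b] the last angle is [- t] up to [k] full turns, so the sum from [m = 0] vanishes; its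
   term at [m = 0] is 1. *)
have -> : 2 * b%:R * t - t = - t + 2 * k%:R * pi by rewrite /t; field.
rewrite sinD_2npi sinN addNr => /eqP.
rewrite !mulf_eq0 pnatr_eq0 (gt_eqF sk) /= big_ltn; last by lia.
by rewrite mulr0 mul0r mulr0 cos0 addrC addr_eq0 => /eqP.
Qed.

Section CotSinSum.
Variables (R : realType) (b : nat).

Definition cot_sin_sum (k : nat) : R :=
  \sum_(1 <= m < b) cot (pi * m%:R / b%:R) * sin (2 * k%:R * (pi * m%:R / b%:R)).

Lemma cot_sin_sum0 : cot_sin_sum 0 = 0.
Proof. by apply: big1 => m _; rewrite mulr0 mul0r sin0 mulr0. Qed.

(** Termwise, sin(x + 2t) - sin x = 2 sin t cos(x + t), which the factor cot t turns into 2 cos t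
    cos(x + t) = cos(x + 2t) + cos x. *)
Lemma cot_sin_sumS (k : nat) : cot_sin_sum k.+1 = cot_sin_sum k
  + (\sum_(1 <= m < b) cos (2 * k.+1%:R * (pi * m%:R / b%:R))
     + \sum_(1 <= m < b) cos (2 * k%:R * (pi * m%:R / b%:R))).
Proof.
rewrite /cot_sin_sum -!big_split; apply: eq_big_nat => m hm /=.
have /lt0r_neq0 s_neq0 := sin_pi_frac_gt0 R _ _ hm.
set t := pi * m%:R / b%:R in s_neq0 *.
have -> : 2 * k.+1%:R * t = 2 * k%:R * t + t + t by rewrite -(natr1 k); ring.
rewrite !(sinD, cosD) /cot.
have h := sin2cos2 t.
set s := sin t in s_neq0 h *; set c := cos t in h *.
(* What remains is a rational identity in [u], [v], [s], [c] modulo [h]. *)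
set u := sin _; set v := cos _.
have -> : (c / s * ((u * c + v * s) * c + (v * c - u * s) * s) =
  c * (c / s * c * u + 2 * v * c - u * s)) by field.
have -> : c / s * c = (1 - s ^+ 2) / s by rewrite h; field.
have -> : (v * c - u * s) * c - (u * c + v * s) * s + v =
  v * (c ^+ 2 - s ^+ 2 + 1) - 2 * u * s * c by ring.
have -> : v * (c ^+ 2 - s ^+ 2 + 1) = 2 * v * c ^+ 2 by rewrite h; ring.
by field.
Qed.

Lemma cot_sin_sum_lt (k : nat) : (0 < k < b)%N -> cot_sin_sum k = b%:R - 2 * k%:R.
Proof.
elim: k => // k IHk hk; rewrite cot_sin_sumS sum_cos_roots_of_unity //.
(* The step from 0 to 1 is exceptional: the cosine sum at 0 is [b - 1], so the value rises by
   [b - 2]; each later step subtracts 2. *)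
case: k IHk hk => [_ hk|k IHk hk].
  rewrite cot_sin_sum0.
  under eq_bigr do rewrite mulr0 mul0r cos0.
  rewrite sumr_const_nat natrB; last by lia.
  ring.
rewrite IHk ?sum_cos_roots_of_unity; [|lia..].
by rewrite -(natr1 k.+1); ring.
Qed.

Lemma cot_sin_sumDM (k q : nat) : cot_sin_sum (k + q * b) = cot_sin_sum k.
Proof.
apply: eq_big_nat => m hm.
have b_neq0 : b%:R != 0 :> R by rewrite pnatr_eq0; lia.
(* Adding [q * b] to [k] adds [q * m] full turns to the angle of term [m]. *)
rewrite -[in RHS](sinD_2npi _ _ (q * m)%N) natrD !natrM.
by congr (_ * sin _); field.
Qed.

Lemma cot_sin3_sumE (a : nat) :
  cot_sin3_sum R 1 a b = (3 * cot_sin_sum a - cot_sin_sum (3 * a)) / 4.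
Proof.
rewrite /cot_sin_sum mulr_sumr -sumrB mulr_suml; apply: eq_bigr => m _.
rewrite natrM.
have -> : 2 * pi * m%:R * 1%:R * (a%:R / b%:R) = 2 * a%:R * (pi * m%:R / b%:R) :> R
  by ring.
rewrite sin_cube.
have -> : 2 * (3%:R * a%:R) * (pi * m%:R / b%:R)
  = 3 * (2 * a%:R * (pi * m%:R / b%:R)) :> R by ring.
by ring.
Qed.

(** With [r = 3 * a - q * b], the difference [3 * (b - 2 * a) - (b - 2 * r)] is
    [2 * b - 2 * q * b]. *)
Lemma cot_sin3_sum_eval (a q r : nat) : (0 < a < b)%N -> (0 < r < b)%N ->
  (3 * a = r + q * b)%N -> cot_sin3_sum R 1 a b = b%:R / 2 - q%:R * b%:R / 2.
Proof.
move=> ha hr e; rewrite cot_sin3_sumE e cot_sin_sumDM !cot_sin_sum_lt //.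
have -> : r%:R = 3 * a%:R - q%:R * b%:R :> R.
  by rewrite -!natrM e natrD addrK.
by field.
Qed.

End CotSinSum.

Theorem proposition1p5 (R : realType) (a b : nat)
    (b_ge2 : (2 <= b)%N) (b_neq3 : b <> 3%N) (coprime_ab : coprime a b)
    (a_ge1 : (1 <= a)%N) (a_le : (a <= b - 1)%N) :
  cot_sin3_sum R 1 a b = b%:R / 2 <->
  exists k : int, (0 <= k /\ k <= b%:Z - 2) /\ b%:Z = 3 * a%:Z + k + 1.
Proof.
have ha : (0 < a < b)%N by lia.
have r_gt0 : (0 < 3 * a %% b)%N.
  rewrite lt0n; apply/negP => b_dvd_3a.
  (* By coprimality [b] would divide 3, hence be 1 or 3. *)
  have : (b %| 3)%N by rewrite -(@Gauss_dvdl _ _ a) // coprime_sym.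
  have /primeP[_ h] : prime 3 by [].
  by move/h => /orP[] /eqP; lia.
have hr : (0 < 3 * a %% b < b)%N by rewrite r_gt0 ltn_mod; lia.
have e : (3 * a = 3 * a %% b + 3 * a %/ b * b)%N by rewrite addnC -divn_eq.
rewrite (cot_sin3_sum_eval R _ _ _ _ ha hr e).
(* Both sides say that [3 * a < b], that is, that the quotient is zero. *)
transitivity ((3 * a %/ b)%N = 0%N).
  split=> [/eqP|->]; last by rewrite !mul0r subr0.
  rewrite -subr_eq0 addrAC subrr sub0r oppr_eq0 !mulf_eq0 invr_eq0 !pnatr_eq0.
  by rewrite (_ : b == 0%N = false) ?orbF /=; [move/eqP | lia].
split=> [q0|[k [[k_ge0 _] ek]]].
  by exists (b%:Z - 3 * a%:Z - 1); split; [split|]; lia.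
by rewrite divn_small //; lia.
Qed.
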